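(* Let $f$ be a smooth real-valued function on an open interval $I \subset \mathbb{R}$. Let $h : I \to \mathbb{R}$ be any real-valued solution of the Sturm-Liouville equation $$h''(v) - \tfrac{1}{2} f(v) h(v) = 0.$$ Then the function $g(v) = (h(v))^2$ is a real-valued solution of the third-order equation $$g'''(v) - 2 f(v) g'(v) - f'(v) g(v) = 0.$$ Moreover, any real-valued solution $g : I \to \mathbb{R}$ of this third-order equation is a linear combination of solutions of this form, i.e. a finite real linear combination of squares of real-valued solutions of the Sturm-Liouville equation. *)

(* Defs.v *)
From Stdlib Require Import Reals List.
From Coquelicot Require Import Coquelicot.
Open Scope R_scope.

(** Functions on an open interval [I] are represented by total functions
    [R -> R].  Since [I] is open, the values of [Derive_n f n] at points of [I]
    depend only on the restriction of [f] to [I]. *)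

Definition Rbar_open_interval (a b : Rbar) (v : R) : Prop :=
  Rbar_lt a (Finite v) /\ Rbar_lt (Finite v) b.

(** All orders [k <= n] are required: [ex_derive_n f n v] alone only says that
    the total function [Derive_n f (n - 1)] is differentiable at [v], and that
    function has a value even where [f] is not differentiable. *)
Definition n_times_differentiable_on
    (D : R -> Prop) (n : nat) (f : R -> R) : Prop :=
  forall (k : nat) (v : R), (k <= n)%nat -> D v -> ex_derive_n f k v.

Definition smooth_on (D : R -> Prop) (f : R -> R) : Prop :=
  forall (n : nat) (v : R), D v -> ex_derive_n f n v.

Definition sturm_liouville_solution
    (D : R -> Prop) (f h : R -> R) : Prop :=
  n_times_differentiable_on D 2 h /\
  forall v : R, D v -> Derive_n h 2 v - 1 / 2 * f v * h v = 0.

Definition third_order_solution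
    (D : R -> Prop) (f g : R -> R) : Prop :=
  n_times_differentiable_on D 3 g /\
  forall v : R, D v ->
    Derive_n g 3 v - 2 * f v * Derive g v - Derive f v * g v = 0.

(** [l] lists the pairs (coefficient, function) of a finite combination of
    squares. *)
Definition lin_comb_squares (l : list (R * (R -> R))) (v : R) : R :=
  fold_right Rplus 0 (map (fun p => fst p * (snd p v) ^ 2) l).

(* Main.v *)
Require Import Defs.
From Stdlib Require Import Reals List Factorial Lra Lia.
From Coquelicot Require Import Coquelicot.
Open Scope R_scope.

(** Write the equations as chains of first derivatives, so that a solution
    comes with its jet: [(h, h')] for h'' = (f/2) h and [(g, g', g'')] for the
    third-order equation L g = g''' - 2 f g' - f' g = 0.

    That squares of Sturm-Liouville solutions solve L g = 0 is a computation:
    (h^2)'' = 2 h'^2 + f h^2, and differentiating once more and replacing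
    4 h' h'' by 2 f h h' gives 4 f h h' + f' h^2.

    For the converse, the operator L is skew-adjoint, so that g L G + G L g is
    the derivative of the symmetric form
    [B(g, G) = g G'' + g'' G - g' G' - 2 f g G]
    ([third_order_form]), which is therefore constant for two solutions
    ([third_order_form_constant]).  Take for G the square of the
    Sturm-Liouville solution with h(v) = 0 and h'(v) = 1.  At v only the term
    2 g(v) of B survives, so 2 g(v) equals the value of B at a base point v0,
    which depends on g only through g(v0), g'(v0), g''(v0).  Hence the jet at v0
    determines g ([third_order_jet_unique]).  It remains to realise an arbitrary
    jet at v0 by squares: if h1, h2 are the solutions with initial data (1, 0)
    and (0, 1), then h1^2, h2^2 and h1 h2 have independent jets at v0, and h1 h2
    is a combination of h1^2, h2^2 and (h1 + h2)^2 by polarisation.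

    All of this needs Sturm-Liouville solutions with given initial data on the
    whole interval ([ex_sturm_liouville_jet]).  They are the sums of the Picard
    series of the system h' = k, k' = q h with q = f/2.  By linearity the n-th
    term is bounded by C (M |x - x0|)^n / n! on a compact subinterval where
    |q| <= M, so that the series converges there together with the series of
    derivatives.  The series is globally defined, hence nothing has to be
    glued. *)

(** * Termwise differentiation of series *)

Lemma is_derive_continuous (F : R -> R) (x l : R) :
  is_derive F x l -> continuous F x.
Proof.
  intros H; apply (ex_derive_continuous (K := R_AbsRing) (V := R_NormedModule)).
  now exists l.
Qed.

Lemma CVU_dom_series_M_test (D : R -> Prop) (u : nat -> R -> R) (B : nat -> R) :
  ex_series B ->
  (forall n x, D x -> Rabs (u n x) <= B n) ->
  CVU_dom (fun n x => sum_n (fun k => u k x) n) D.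
Proof.
  intros HB Hu.
  apply CVU_dom_cauchy; intros eps.
  destruct (Cauchy_ex_series B HB eps) as [N HN].
  exists N.
  assert (Htail : forall n m x, D x -> (N <= n)%nat -> (n < m)%nat ->
    Rabs (sum_n (fun k => u k x) m - sum_n (fun k => u k x) n) < eps).
  { intros n m x Hx HNn Hnm.
    pose proof (sum_n_m_sum_n (G := R_AbelianGroup) (fun k => u k x) n m
                  ltac:(lia)) as E.
    change (sum_n_m (fun k => u k x) (S n) m =
            sum_n (fun k => u k x) m - sum_n (fun k => u k x) n) in E.
    rewrite <- E.
    eapply Rle_lt_trans; [apply (norm_sum_n_m (V := R_NormedModule))|].
    eapply Rle_lt_trans; [apply sum_n_m_le with (b := B); intros k; now apply Hu|].
    eapply Rle_lt_trans; [apply Rle_abs|].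
    apply (HN (S n) m); lia. }
  intros n m x Hx Hn Hm.
  destruct (Nat.lt_trichotomy n m) as [Hlt | [-> | Hlt]].
  - rewrite Rabs_minus_sym; now apply Htail.
  - unfold Rminus; rewrite Rplus_opp_r, Rabs_R0; apply cond_pos.
  - now apply Htail.
Qed.

Lemma continuous_sum_n (u : nat -> R -> R) (x : R) (n : nat) :
  (forall k, continuous (u k) x) ->
  continuous (fun y => sum_n (fun k => u k y) n) x.
Proof.
  intros Hu; induction n as [|n IH].
  - apply continuous_ext with (2 := Hu 0%nat).
    intros y; now rewrite sum_O.
  - apply continuous_ext with
      (f := fun y => plus (sum_n (fun k => u k y) n) (u (S n) y)).
    + intros y; now rewrite sum_Sn.
    + now apply (continuous_plus (V := R_NormedModule)).
Qed.

(** Both series satisfy the Weierstrass M-test, so the partial sums and their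
    derivatives converge uniformly. *)
Lemma is_derive_Series (D : R -> Prop) (u u' : nat -> R -> R) (B B' : nat -> R) :
  open D -> is_connected D -> ex_series B -> ex_series B' ->
  (forall n x, D x -> Rabs (u n x) <= B n) ->
  (forall n x, D x -> Rabs (u' n x) <= B' n) ->
  (forall n x, D x -> is_derive (u n) x (u' n x)) ->
  (forall n x, D x -> continuous (u' n) x) ->
  forall x, D x ->
    is_derive (fun y => Series (fun n => u n y)) x (Series (fun n => u' n x)).
Proof.
  intros HDo HDc HB HB' Hu Hu' Hder Hcont x Hx.
  set (partial := fun n y => sum_n (fun k => u k y) n).
  assert (HS : forall n y, D y ->
            is_derive (partial n) y (sum_n (fun k => u' k y) n)).
  { intros n y Hy; apply (is_derive_sum_n (K := R_AbsRing) (V := R_NormedModule)).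
    intros k _; now apply Hder. }
  assert (HDS : forall n y, D y -> Derive (partial n) y = sum_n (fun k => u' k y) n).
  { intros n y Hy; now apply is_derive_unique, HS. }
  replace (Series (fun n => u' n x))
    with (real (Lim_seq (fun n => Derive (partial n) x))).
  2: { unfold Series; f_equal; apply Lim_seq_ext; intros n; now apply HDS. }
  apply (CVU_Derive partial D); trivial.
  - now apply CVU_dom_series_M_test with B.
  - intros n y Hy; eexists; now apply HS.
  - intros n y Hy; apply continuity_pt_filterlim.
    apply (continuous_ext_loc (Derive (partial n)) (fun y => sum_n (fun k => u' k y) n)).
    + destruct (HDo y Hy) as [e He]; exists e; intros z Hz.
      symmetry; now apply HDS, He.
    + apply continuous_sum_n; intros k; now apply Hcont.
  - pose proof (CVU_dom_series_M_test D u' B' HB' Hu') as HC.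
    intros eps; destruct (HC eps) as [N HN]; exists N; intros n Hn y Hy.
    rewrite HDS by trivial.
    rewrite (Lim_seq_ext _ (fun n => sum_n (fun k => u' k y) n)).
    + now apply HN.
    + intros m; now apply HDS.
Qed.

(** * The Picard series of the system h' = k, k' = q h *)

Lemma growth_bound_right (F F' : R -> R) (x0 x K : R) (n : nat) :
  x0 <= x -> F x0 = 0 ->
  (forall t, x0 <= t <= x -> is_derive F t (F' t)) ->
  (forall t, x0 <= t <= x -> Rabs (F' t) <= K * (t - x0) ^ n) ->
  Rabs (F x) <= K * (x - x0) ^ S n / INR (S n).
Proof.
  intros Hx HF0 HF HF'.
  assert (HSn : INR (S n) <> 0) by (apply not_0_INR; lia).
  (* The difference of the majorant and [s * F], where s is a sign, is
     nondecreasing and vanishes at [x0]; the two signs bound [F] on both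
     sides. *)
  assert (Hs : forall s, s * s = 1 ->
            s * F x <= K * (x - x0) ^ S n / INR (S n)).
  { intros s Hs.
    assert (Hd : forall t, x0 <= t <= x ->
      is_derive (fun t => K * (t - x0) ^ S n / INR (S n) - s * F t) t
        (K * (t - x0) ^ n - s * F' t)).
    { intros t Ht; pose proof (HF t Ht) as Hd.
      auto_derive; [repeat split; trivial; now exists (F' t)|].
      change (Derive (fun x1 => F x1) t) with (Derive F t).
      rewrite (is_derive_unique _ _ _ Hd).
      change (match n with 0%nat => 1 | S _ => INR n + 1 end) with (INR (S n)).
      simpl Nat.pred; unfold Rminus. now field. }
    destruct (MVT_gen (fun t => K * (t - x0) ^ S n / INR (S n) - s * F t) x0 x
                (fun t => K * (t - x0) ^ n - s * F' t)) as [t [Ht E]].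
    { intros t Ht; apply Hd; rewrite Rmin_left, Rmax_right in Ht; lra. }
    { intros t Ht; rewrite Rmin_left, Rmax_right in Ht by trivial.
      apply continuity_pt_filterlim.
      now apply is_derive_continuous with (1 := Hd t Ht). }
    rewrite Rmin_left, Rmax_right in Ht by trivial.
    pose proof (HF' t Ht) as Hb; apply Rabs_le_between in Hb.
    assert (Hs1 : s = 1 \/ s = -1).
    { assert (Hz : (s - 1) * (s + 1) = 0) by lra.
      apply Rmult_integral in Hz; lra. }
    assert (Hpos : 0 <= (K * (t - x0) ^ n - s * F' t) * (x - x0)).
    { apply Rmult_le_pos; [destruct Hs1; subst s; lra | lra]. }
    rewrite HF0 in E.
    replace (x0 - x0) with 0 in E by ring.
    rewrite pow_i in E by lia.
    unfold Rdiv in E |- *; rewrite Rmult_0_r, Rmult_0_l in E; lra. }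
  apply Rabs_le_between; split.
  - specialize (Hs (-1) ltac:(lra)); lra.
  - specialize (Hs 1 ltac:(lra)); lra.
Qed.

(** The case [x < x0] reduces to [growth_bound_right] by the reflection
    t |-> 2 x0 - t. *)
Lemma growth_bound (F F' : R -> R) (x0 x K : R) (n : nat) :
  F x0 = 0 ->
  (forall t, Rmin x0 x <= t <= Rmax x0 x -> is_derive F t (F' t)) ->
  (forall t, Rmin x0 x <= t <= Rmax x0 x -> Rabs (F' t) <= K * Rabs (t - x0) ^ n) ->
  Rabs (F x) <= K * Rabs (x - x0) ^ S n / INR (S n).
Proof.
  intros HF0 HF HF'.
  destruct (Rle_lt_dec x0 x) as [Hx | Hx].
  - rewrite Rmin_left, Rmax_right in HF, HF' by lra.
    rewrite (Rabs_pos_eq (x - x0)) by lra.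
    apply growth_bound_right with F'; trivial.
    intros t Ht; rewrite <- (Rabs_pos_eq (t - x0)) by lra; now apply HF'.
  - rewrite Rmin_right, Rmax_left in HF, HF' by lra.
    rewrite (Rabs_left (x - x0)) by lra.
    replace (F x) with (F (2 * x0 - (2 * x0 - x))) by (f_equal; ring).
    replace (- (x - x0)) with ((2 * x0 - x) - x0) by ring.
    apply (growth_bound_right (fun t => F (2 * x0 - t))
             (fun t => - F' (2 * x0 - t))).
    + lra.
    + now replace (2 * x0 - x0) with x0 by ring.
    + intros t Ht.
      assert (Hd := HF (2 * x0 - t) ltac:(lra)).
      replace (- F' (2 * x0 - t)) with (scal (-1) (F' (2 * x0 - t)))
        by (unfold scal; simpl; unfold mult; simpl; ring).
      apply (is_derive_comp F (fun t => 2 * x0 - t)); [exact Hd|].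
      auto_derive; [trivial | ring].
    + intros t Ht; rewrite Rabs_Ropp.
      eapply Rle_trans; [apply HF'; lra|].
      rewrite Rabs_left1 by lra.
      apply Req_le; do 2 f_equal; ring.
Qed.

(** The differences of successive Picard iterates: since the system is linear,
    each is obtained from the previous one by a single integration. *)
Fixpoint picard_term (q : R -> R) (x0 y0 z0 : R) (n : nat) : (R -> R) * (R -> R) :=
  match n with
  | O => (fun _ => y0, fun _ => z0)
  | S m => (fun x => RInt (snd (picard_term q x0 y0 z0 m)) x0 x,
            fun x => RInt (fun t => q t * fst (picard_term q x0 y0 z0 m) t) x0 x)
  end.

Lemma is_derive_RInt_open (D : R -> Prop) (phi : R -> R) (x0 x : R) :
  open D -> is_connected D -> D x0 -> D x ->
  (forall t, D t -> continuous phi t) ->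
  is_derive (fun x => RInt phi x0 x) x (phi x).
Proof.
  intros HDo HDc H0 Hx Hphi.
  apply is_derive_RInt with (a := x0); [|now apply Hphi].
  destruct (HDo x Hx) as [e He]; exists e; intros y Hy.
  apply (RInt_correct (V := R_CompleteNormedModule)).
  apply (ex_RInt_continuous (V := R_CompleteNormedModule)).
  intros z Hz; apply Hphi.
  apply (HDc (Rmin x0 y) (Rmax x0 y)); trivial.
  - unfold Rmin; destruct (Rle_dec x0 y); [trivial | now apply He].
  - unfold Rmax; destruct (Rle_dec x0 y); [now apply He | trivial].
Qed.

Lemma ex_compact_enclosure (D : R -> Prop) (x0 x : R) :
  open D -> is_connected D -> D x0 -> D x ->
  exists c d, c < x0 < d /\ c < x < d /\ (forall t, c <= t <= d -> D t).
Proof.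
  intros HDo HDc HD0 Hx.
  destruct (HDo x0 HD0) as [e0 He0], (HDo x Hx) as [e He].
  set (e1 := Rmin e0 e / 2).
  assert (He1 : 0 < e1 /\ e1 < e0 /\ e1 < e).
  { pose proof (cond_pos e0); pose proof (cond_pos e).
    unfold e1, Rmin; destruct (Rle_dec e0 e); lra. }
  assert (Hball : forall y (e2 : posreal) s, Rabs (s - y) < e2 -> ball y e2 s)
    by (intros; assumption).
  assert (Hm : D (Rmin x0 x - e1)).
  { unfold Rmin; destruct (Rle_dec x0 x); [apply He0 | apply He];
      apply Hball; apply Rabs_lt_between; lra. }
  assert (HM : D (Rmax x0 x + e1)).
  { unfold Rmax; destruct (Rle_dec x0 x); [apply He | apply He0];
      apply Hball; apply Rabs_lt_between; lra. }
  exists (Rmin x0 x - e1), (Rmax x0 x + e1).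
  pose proof (Rmin_l x0 x); pose proof (Rmin_r x0 x).
  pose proof (Rmax_l x0 x); pose proof (Rmax_r x0 x).
  split; [lra|]; split; [lra|].
  intros t Ht; now apply (HDc _ _ t Hm HM).
Qed.

Section Picard.

Variables (D : R -> Prop) (q : R -> R) (x0 y0 z0 : R).
Hypotheses (HDo : open D) (HDc : is_connected D) (HD0 : D x0)
  (Hq : forall t, D t -> continuous q t).

Let p n := fst (picard_term q x0 y0 z0 n).
Let r n := snd (picard_term q x0 y0 z0 n).
(* The derivatives of [p n] and [r n]. *)
Let p' n x := match n with O => 0 | S m => r m x end.
Let r' n x := match n with O => 0 | S m => q x * p m x end.

Lemma picard_term_derive n :
  forall x, D x -> is_derive (p n) x (p' n x) /\ is_derive (r n) x (r' n x).
Proof.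
  induction n as [|n IH]; intros x Hx.
  - split; [exact (is_derive_const y0 x) | exact (is_derive_const z0 x)].
  - assert (Hc : forall t, D t -> continuous (p n) t /\ continuous (r n) t).
    { intros t Ht; destruct (IH t Ht) as [Hp Hr].
      split; [exact (is_derive_continuous _ _ _ Hp)
             | exact (is_derive_continuous _ _ _ Hr)]. }
    split.
    + apply (is_derive_RInt_open D (r n)); trivial.
      intros t Ht; now apply Hc.
    + apply (is_derive_RInt_open D (fun t => q t * p n t)); trivial.
      intros t Ht; apply (continuous_mult q (p n)); [now apply Hq | now apply Hc].
Qed.

Lemma picard_term_continuous n x : D x -> continuous (p n) x /\ continuous (r n) x.
Proof.
  intros Hx; destruct (picard_term_derive n x Hx) as [Hp Hr].
  split; [exact (is_derive_continuous _ _ _ Hp)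
         | exact (is_derive_continuous _ _ _ Hr)].
Qed.

(** Requiring [1 <= M] lets the same constant serve both equations of the
    system, whose coefficients are 1 and [q]. *)
Lemma picard_term_bound (M : R) (c d : R) :
  1 <= M -> c <= x0 <= d ->
  (forall t, c <= t <= d -> D t /\ Rabs (q t) <= M) ->
  forall n x, c <= x <= d ->
    let b := (Rabs y0 + Rabs z0) * M ^ n / INR (fact n) * Rabs (x - x0) ^ n in
    Rabs (p n x) <= b /\ Rabs (r n x) <= b.
Proof.
  intros HM H0 HqM n; induction n as [|n IH]; intros x Hx b.
  - unfold b, p, r; simpl.
    pose proof (Rabs_pos y0); pose proof (Rabs_pos z0); lra.
  - assert (Hb : b = (Rabs y0 + Rabs z0) * M ^ n / INR (fact n) * M
                     * Rabs (x - x0) ^ S n / INR (S n)).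
    { unfold b; rewrite fact_simpl, mult_INR, <- (tech_pow_Rmult M).
      field; split; [apply INR_fact_neq_0 | apply not_0_INR; lia]. }
    rewrite Hb.
    assert (Hin : forall t, Rmin x0 x <= t <= Rmax x0 x -> c <= t <= d).
    { intros t; unfold Rmin, Rmax; destruct (Rle_dec x0 x); lra. }
    split.
    + apply (growth_bound (p (S n)) (p' (S n))).
      * apply (RInt_point (V := R_CompleteNormedModule)).
      * intros t Ht; apply (picard_term_derive (S n)), HqM; now apply Hin.
      * intros t Ht; destruct (IH t (Hin t Ht)) as [_ Hr].
        pose proof (Rabs_pos (r n t)).
        simpl; eapply Rle_trans; [exact Hr|].
        rewrite <- (Rmult_1_l (_ * _)) at 1.
        rewrite (Rmult_comm _ M), Rmult_assoc.
        apply Rmult_le_compat_r; lra.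
    + apply (growth_bound (r (S n)) (r' (S n))).
      * apply (RInt_point (V := R_CompleteNormedModule)).
      * intros t Ht; apply (picard_term_derive (S n)), HqM; now apply Hin.
      * intros t Ht; destruct (IH t (Hin t Ht)) as [Hp _].
        simpl; rewrite Rabs_mult, (Rmult_comm _ M), Rmult_assoc.
        apply Rmult_le_compat; try apply Rabs_pos; trivial.
        apply HqM; now apply Hin.
Qed.

(** Differentiability at [x] is local, so the M-test is only needed on a bounded
    interval containing [x0] and [x] on whose closure [q] is bounded; the
    majorants are the terms of an exponential series. *)
Lemma picard_series_derive x :
  D x ->
  is_derive (fun x => Series (fun n => p n x)) x (Series (fun n => r n x)) /\
  is_derive (fun x => Series (fun n => r n x)) x (q x * Series (fun n => p n x)).
Proof.
  intros Hx.
  destruct (ex_compact_enclosure D x0 x HDo HDc HD0 Hx) as (c & d & H0 & Hxcd & HDcd).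
  destruct (continuity_ab_maj (fun t => Rabs (q t)) c d) as [m [Hm _]]; [lra| |].
  { intros t Ht; apply continuity_pt_filterlim.
    apply (continuous_comp q Rabs); [now apply Hq, HDcd | apply continuous_Rabs]. }
  set (M := Rabs (q m) + 1).
  set (C := Rabs y0 + Rabs z0).
  set (B := fun n => C * (M * (d - c)) ^ n / INR (fact n)).
  set (B' := fun n => match n with O => 0 | S k => M * B k end).
  assert (HM : 1 <= M) by (pose proof (Rabs_pos (q m)); unfold M; lra).
  assert (HC : 0 <= C)
    by (pose proof (Rabs_pos y0); pose proof (Rabs_pos z0); unfold C; lra).
  assert (HqM : forall t, c < t < d -> Rabs (q t) <= M)
    by (intros t Ht; specialize (Hm t ltac:(lra)); unfold M; lra).
  assert (HpB : forall n t, c < t < d -> Rabs (p n t) <= B n /\ Rabs (r n t) <= B n).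
  { intros n t Ht.
    assert (Hle : C * M ^ n / INR (fact n) * Rabs (t - x0) ^ n <= B n).
    { unfold B; rewrite Rpow_mult_distr.
      replace (C * (M ^ n * (d - c) ^ n) / INR (fact n))
        with (C * M ^ n / INR (fact n) * (d - c) ^ n)
        by (field; apply INR_fact_neq_0).
      apply Rmult_le_compat_l.
      - apply Rdiv_le_0_compat; [|apply INR_fact_lt_0].
        apply Rmult_le_pos; [trivial | apply pow_le; lra].
      - apply pow_incr; split; [apply Rabs_pos | apply Rabs_le_between; lra]. }
    destruct (picard_term_bound M c d HM ltac:(lra)) with (n := n) (x := t)
      as [Hp Hr]; [ | lra | ].
    { intros s Hs; split; [now apply HDcd | specialize (Hm s Hs); unfold M; lra]. }
    fold C in Hp, Hr; lra. }
  assert (HBs : ex_series B).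
  { apply ex_series_ext with
      (fun n => scal C (scal (pow_n (M * (d - c)) n) (/ INR (fact n)))).
    - intros n; unfold B, scal; simpl; unfold mult; simpl.
      rewrite pow_n_pow; unfold Rdiv; ring.
    - apply (ex_series_scal (K := R_AbsRing) (V := R_NormedModule)).
      eexists; apply is_exp_Reals. }
  assert (HBs' : ex_series B').
  { apply ex_series_incr_1; simpl.
    now apply (ex_series_scal (K := R_AbsRing) (V := R_NormedModule) M B). }
  assert (HB0 : forall n t, c < t < d -> 0 <= B n).
  { intros n t Ht; destruct (HpB n t Ht) as [Hp _].
    pose proof (Rabs_pos (p n t)); lra. }
  assert (Hp'B : forall n t, c < t < d -> Rabs (p' n t) <= B' n).
  { intros [|n] t Ht; simpl; [rewrite Rabs_R0; lra|].
    destruct (HpB n t Ht) as [_ Hr]; pose proof (HB0 n t Ht).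
    rewrite <- (Rmult_1_l (Rabs _)).
    apply Rmult_le_compat; try lra; apply Rabs_pos. }
  assert (Hr'B : forall n t, c < t < d -> Rabs (r' n t) <= B' n).
  { intros [|n] t Ht; simpl; [rewrite Rabs_R0; lra|].
    destruct (HpB n t Ht) as [Hp _].
    rewrite Rabs_mult.
    apply Rmult_le_compat; try apply Rabs_pos; [now apply HqM | trivial]. }
  assert (Ho : open (fun t => c < t < d)).
  { apply open_and; [apply open_gt | apply open_lt]. }
  assert (Hcn : is_connected (fun t => c < t < d)) by (intros u v w; lra).
  assert (Hp's : ex_series (fun n => p' n x)).
  { apply (ex_series_le (K := R_AbsRing) (V := R_CompleteNormedModule)) with B';
      [intros n; now apply Hp'B | trivial]. }
  assert (Hr's : ex_series (fun n => r' n x)).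
  { apply (ex_series_le (K := R_AbsRing) (V := R_CompleteNormedModule)) with B';
      [intros n; now apply Hr'B | trivial]. }
  split.
  - replace (Series (fun n => r n x)) with (Series (fun n => p' n x))
      by (rewrite Series_incr_1 by trivial; simpl; ring).
    apply (is_derive_Series (fun t => c < t < d) p p' B B'); trivial.
    + intros n t Ht; now apply HpB.
    + intros n t Ht; apply picard_term_derive, HDcd; lra.
    + intros [|n] t Ht; [apply continuous_const|].
      apply (picard_term_continuous n), HDcd; lra.
  - replace (q x * Series (fun n => p n x)) with (Series (fun n => r' n x))
      by (rewrite Series_incr_1 by trivial; simpl; rewrite Series_scal_l; ring).
    apply (is_derive_Series (fun t => c < t < d) r r' B B'); trivial.
    + intros n t Ht; now apply HpB.
    + intros n t Ht; apply picard_term_derive, HDcd; lra.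
    + intros [|n] t Ht; [apply continuous_const|].
      apply (continuous_mult q (p n)); [apply Hq, HDcd; lra|].
      apply (picard_term_continuous n), HDcd; lra.
Qed.

Lemma picard_series_initial :
  Series (fun n => p n x0) = y0 /\ Series (fun n => r n x0) = z0.
Proof.
  assert (H : forall (a : nat -> R) l, a O = l -> (forall n, a (S n) = 0) ->
            Series a = l).
  { intros a l Ha0 HaS.
    apply is_series_unique.
    apply (is_series_decr_1 (K := R_AbsRing) (V := R_NormedModule)).
    apply is_series_ext with (fun _ => 0); [intros n; symmetry; apply HaS|].
    unfold plus, opp; simpl; rewrite Ha0, Rplus_opp_r.
    change (is_lim_seq (sum_n (fun _ => 0)) 0).
    apply is_lim_seq_ext with (fun _ => 0); [|apply is_lim_seq_const].
    intros n; rewrite sum_n_const; ring. }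
  split; apply H; trivial; intros n;
    apply (RInt_point (V := R_CompleteNormedModule)).
Qed.

End Picard.

(** * Solutions and their jets *)

(** Chains of [is_derive] facts are stable under algebraic operations on the
    solutions, whereas iterated derivatives would need local rewriting at each
    order. *)
Definition sturm_liouville_jet (D : R -> Prop) (f h k : R -> R) : Prop :=
  forall v, D v -> is_derive h v (k v) /\ is_derive k v (1 / 2 * f v * h v).

Definition third_order_jet (D : R -> Prop) (f g g1 g2 : R -> R) : Prop :=
  forall v, D v ->
    is_derive g v (g1 v) /\ is_derive g1 v (g2 v) /\
    is_derive g2 v (2 * f v * g1 v + Derive f v * g v).

Lemma ex_sturm_liouville_jet (D : R -> Prop) (f : R -> R) (v0 y0 z0 : R) :
  open D -> is_connected D -> D v0 -> (forall v, D v -> continuous f v) ->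
  exists h k, sturm_liouville_jet D f h k /\ h v0 = y0 /\ k v0 = z0.
Proof.
  intros HDo HDc H0 Hf.
  set (q := fun v => 1 / 2 * f v).
  exists (fun v => Series (fun n => fst (picard_term q v0 y0 z0 n) v)).
  exists (fun v => Series (fun n => snd (picard_term q v0 y0 z0 n) v)).
  split.
  - intros v Hv.
    apply (picard_series_derive D q v0 y0 z0); trivial.
    intros t Ht.
    apply (continuous_mult (fun _ => 1 / 2) f);
      [apply continuous_const | now apply Hf].
  - apply picard_series_initial.
Qed.

Lemma Derive_n_chain (D : R -> Prop) (n : nat) (f : R -> R) :
  n_times_differentiable_on D n f ->
  forall k v, (k < n)%nat -> D v ->
    is_derive (Derive_n f k) v (Derive_n f (S k) v).
Proof.
  intros Hf k v Hk Hv.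
  apply (Derive_correct (Derive_n f k)).
  apply (Hf (S k) v); [lia | trivial].
Qed.

(** Iterated derivatives of [F 0] are read off a chain of successive
    derivatives; openness of [D] is what allows differentiating an equality
    that holds only on [D]. *)
Lemma Derive_n_jet (D : R -> Prop) (F : nat -> R -> R) (n : nat) :
  open D ->
  (forall k v, (k < n)%nat -> D v -> is_derive (F k) v (F (S k) v)) ->
  n_times_differentiable_on D n (F O) /\
  (forall k v, (k <= n)%nat -> D v -> Derive_n (F O) k v = F k v).
Proof.
  intros HDo HF.
  assert (HD : forall k v, (k <= n)%nat -> D v -> Derive_n (F O) k v = F k v).
  { induction k as [|k IH]; intros v Hk Hv; trivial.
    simpl; rewrite (Derive_ext_loc _ (F k)).
    - now apply is_derive_unique, HF.
    - destruct (HDo v Hv) as [e He]; exists e; intros w Hw.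
      apply IH; [lia | now apply He]. }
  split; trivial.
  intros [|k] v Hk Hv; simpl; trivial.
  apply ex_derive_ext_loc with (F k).
  - destruct (HDo v Hv) as [e He]; exists e; intros w Hw.
    symmetry; apply HD; [lia | now apply He].
  - eexists; now apply HF.
Qed.

Lemma sturm_liouville_solution_jet (D : R -> Prop) (f h : R -> R) :
  sturm_liouville_solution D f h ->
  sturm_liouville_jet D f h (Derive h).
Proof.
  intros [Hd Hh] v Hv.
  split; [apply (Derive_n_chain D 2 h Hd 0 v); [lia | trivial]|].
  replace (1 / 2 * f v * h v) with (Derive_n h 2 v)
    by (specialize (Hh v Hv); lra).
  apply (Derive_n_chain D 2 h Hd 1 v); [lia | trivial].
Qed.

Lemma sturm_liouville_jet_solution (D : R -> Prop) (f h k : R -> R) :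
  open D -> sturm_liouville_jet D f h k -> sturm_liouville_solution D f h.
Proof.
  intros HDo Hh.
  destruct (Derive_n_jet D
    (fun n => match n with
              | O => h | 1%nat => k | _ => fun v => 1 / 2 * f v * h v
              end) 2 HDo) as [Hd HD].
  { intros [|[|n]] v Hn Hv; [apply Hh | apply Hh | lia]; trivial. }
  split; trivial.
  intros v Hv; rewrite (HD 2%nat v) by (trivial; lia); ring.
Qed.

Lemma third_order_solution_jet (D : R -> Prop) (f g : R -> R) :
  third_order_solution D f g ->
  third_order_jet D f g (Derive g) (Derive_n g 2).
Proof.
  intros [Hd Hg] v Hv.
  split; [apply (Derive_n_chain D 3 g Hd 0 v); [lia | trivial]|].
  split; [apply (Derive_n_chain D 3 g Hd 1 v); [lia | trivial]|].
  replace (2 * f v * Derive g v + Derive f v * g v) with (Derive_n g 3 v)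
    by (specialize (Hg v Hv); lra).
  apply (Derive_n_chain D 3 g Hd 2 v); [lia | trivial].
Qed.

Lemma third_order_jet_solution (D : R -> Prop) (f g g1 g2 : R -> R) :
  open D -> third_order_jet D f g g1 g2 -> third_order_solution D f g.
Proof.
  intros HDo Hg.
  destruct (Derive_n_jet D
    (fun n => match n with
              | O => g | 1%nat => g1 | 2%nat => g2
              | _ => fun v => 2 * f v * g1 v + Derive f v * g v
              end) 3 HDo) as [Hd HD].
  { intros [|[|[|n]]] v Hn Hv; [apply Hg | apply Hg | apply Hg | lia]; trivial. }
  split; trivial.
  intros v Hv; rewrite (HD 3%nat v) by (trivial; lia).
  change (Derive g v) with (Derive_n g 1 v).
  rewrite (HD 1%nat v) by (trivial; lia); ring.
Qed.

Lemma sturm_liouville_jet_plus (D : R -> Prop) (f h1 k1 h2 k2 : R -> R) :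
  sturm_liouville_jet D f h1 k1 -> sturm_liouville_jet D f h2 k2 ->
  sturm_liouville_jet D f (fun v => h1 v + h2 v) (fun v => k1 v + k2 v).
Proof.
  intros H1 H2 v Hv; destruct (H1 v Hv) as [H1a H1b], (H2 v Hv) as [H2a H2b].
  split; [now apply (is_derive_plus (K := R_AbsRing) (V := R_NormedModule))|].
  replace (1 / 2 * f v * (h1 v + h2 v))
    with (plus (1 / 2 * f v * h1 v) (1 / 2 * f v * h2 v))
    by (unfold plus; simpl; ring).
  now apply (is_derive_plus (K := R_AbsRing) (V := R_NormedModule)).
Qed.

Lemma third_order_jet_lin (D : R -> Prop) (f g g1 g2 h h1 h2 : R -> R) (a b : R) :
  third_order_jet D f g g1 g2 -> third_order_jet D f h h1 h2 ->
  third_order_jet D f (fun v => a * g v + b * h v)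
    (fun v => a * g1 v + b * h1 v) (fun v => a * g2 v + b * h2 v).
Proof.
  intros Hg Hh v Hv; destruct (Hg v Hv) as (G0 & G1 & G2), (Hh v Hv) as (K0 & K1 & K2).
  assert (Hlin : forall (u w : R -> R) du dw, is_derive u v du -> is_derive w v dw ->
            is_derive (fun v => a * u v + b * w v) v (a * du + b * dw)).
  { intros u w du dw Hu Hw.
    apply (is_derive_plus (K := R_AbsRing) (V := R_NormedModule));
      now apply is_derive_scal. }
  split; [now apply Hlin|]; split; [now apply Hlin|].
  replace (2 * f v * (a * g1 v + b * h1 v) + Derive f v * (a * g v + b * h v))
    with (a * (2 * f v * g1 v + Derive f v * g v)
          + b * (2 * f v * h1 v + Derive f v * h v)) by ring.
  now apply Hlin.
Qed.

Lemma third_order_jet_square (D : R -> Prop) (f h k : R -> R) :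
  (forall v, D v -> ex_derive f v) ->
  sturm_liouville_jet D f h k ->
  third_order_jet D f (fun v => h v ^ 2) (fun v => 2 * h v * k v)
    (fun v => 2 * k v ^ 2 + f v * h v ^ 2).
Proof.
  intros Hf Hh v Hv; destruct (Hh v Hv) as [Dh Dk].
  assert (Ef := Hf v Hv).
  assert (Eh : ex_derive h v) by (eexists; exact Dh).
  assert (Ek : ex_derive k v) by (eexists; exact Dk).
  split; [|split]; auto_derive; repeat split; trivial;
    change (Derive (fun x => h x) v) with (Derive h v);
    change (Derive (fun x => k x) v) with (Derive k v);
    change (Derive (fun x => f x) v) with (Derive f v);
    rewrite ?(is_derive_unique _ _ _ Dh), ?(is_derive_unique _ _ _ Dk); field.
Qed.

(** * Uniqueness for the third-order equation *)

(** The bilinear concomitant of the skew-adjoint operator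
    g''' - 2 f g' - f' g.  On the squares of two Sturm-Liouville solutions it is
    twice the square of their Wronskian. *)
Definition third_order_form (f g g1 g2 h h1 h2 : R -> R) (v : R) : R :=
  g v * h2 v + g2 v * h v - g1 v * h1 v - 2 * f v * g v * h v.

Lemma third_order_form_constant (D : R -> Prop) (f g g1 g2 h h1 h2 : R -> R) :
  is_connected D -> (forall v, D v -> ex_derive f v) ->
  third_order_jet D f g g1 g2 -> third_order_jet D f h h1 h2 ->
  forall v w, D v -> D w ->
    third_order_form f g g1 g2 h h1 h2 v = third_order_form f g g1 g2 h h1 h2 w.
Proof.
  intros HDc Hf Hg Hh v w Hv Hw.
  assert (Hd : forall t, D t -> is_derive (third_order_form f g g1 g2 h h1 h2) t 0).
  { intros t Ht; destruct (Hg t Ht) as (G0 & G1 & G2), (Hh t Ht) as (K0 & K1 & K2).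
    assert (Ef := Hf t Ht); unfold third_order_form.
    auto_derive.
    - repeat split; trivial; eexists; eassumption.
    - change (Derive (fun x => f x) t) with (Derive f t).
      change (Derive (fun x => g x) t) with (Derive g t).
      change (Derive (fun x => g1 x) t) with (Derive g1 t).
      change (Derive (fun x => g2 x) t) with (Derive g2 t).
      change (Derive (fun x => h x) t) with (Derive h t).
      change (Derive (fun x => h1 x) t) with (Derive h1 t).
      change (Derive (fun x => h2 x) t) with (Derive h2 t).
      rewrite (is_derive_unique _ _ _ G0), (is_derive_unique _ _ _ G1),
        (is_derive_unique _ _ _ G2), (is_derive_unique _ _ _ K0),
        (is_derive_unique _ _ _ K1), (is_derive_unique _ _ _ K2); ring. }
  assert (Hin : forall t, Rmin v w <= t <= Rmax v w -> D t).
  { intros t; unfold Rmin, Rmax; destruct (Rle_dec v w); intros Ht;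
      [now apply (HDc v w) | now apply (HDc w v)]. }
  destruct (MVT_gen (third_order_form f g g1 g2 h h1 h2) v w (fun _ => 0))
    as [t [_ E]].
  - intros t Ht; apply Hd, Hin; lra.
  - intros t Ht; apply continuity_pt_filterlim.
    now apply is_derive_continuous with (1 := Hd t (Hin t Ht)).
  - lra.
Qed.

(** Pairing a solution with the square of the Sturm-Liouville solution with data
    (0, 1) at [v] gives twice its value at [v], and the pairing can be evaluated
    at [v0]. *)
Lemma third_order_jet_unique (D : R -> Prop) (f g g1 g2 h h1 h2 : R -> R) (v0 : R) :
  open D -> is_connected D -> (forall v, D v -> ex_derive f v) ->
  third_order_jet D f g g1 g2 -> third_order_jet D f h h1 h2 ->
  D v0 -> g v0 = h v0 -> g1 v0 = h1 v0 -> g2 v0 = h2 v0 ->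
  forall v, D v -> g v = h v.
Proof.
  intros HDo HDc Hf Hg Hh H0 E0 E1 E2 v Hv.
  assert (Hfc : forall t, D t -> continuous f t)
    by (intros t Ht; apply (ex_derive_continuous (K := R_AbsRing)
          (V := R_NormedModule)), Hf, Ht).
  destruct (ex_sturm_liouville_jet D f v 0 1 HDo HDc Hv Hfc)
    as (y & z & Hy & Hy0 & Hz0).
  pose proof (third_order_jet_square D f y z Hf Hy) as Hsq.
  pose proof (third_order_form_constant D f _ _ _ _ _ _ HDc Hf Hg Hsq v v0 Hv H0) as Cg.
  pose proof (third_order_form_constant D f _ _ _ _ _ _ HDc Hf Hh Hsq v v0 Hv H0) as Ch.
  unfold third_order_form in Cg, Ch.
  rewrite E0, E1, E2, <- Ch, Hy0, Hz0 in Cg.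
  lra.
Qed.

(** * Spanning by squares *)

Theorem proposition4p1 (a b : Rbar) (f : R -> R)
    (hf : smooth_on (Rbar_open_interval a b) f) :
  (forall h : R -> R,
     sturm_liouville_solution (Rbar_open_interval a b) f h ->
     third_order_solution (Rbar_open_interval a b) f (fun v : R => (h v) ^ 2)) /\
  (forall g : R -> R,
     third_order_solution (Rbar_open_interval a b) f g ->
     exists l : list (R * (R -> R)),
       (forall (c : R) (h : R -> R), In (c, h) l ->
          sturm_liouville_solution (Rbar_open_interval a b) f h) /\
       (forall v : R, Rbar_open_interval a b v -> g v = lin_comb_squares l v)).
Proof.
  set (D := Rbar_open_interval a b) in *.
  assert (HDo : open D) by (apply open_and; [apply open_Rbar_gt | apply open_Rbar_lt]).
  assert (HDc : is_connected D).
  { intros u w v [Hu _] [_ Hw] Hv; split.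
    - apply Rbar_lt_le_trans with (1 := Hu); simpl; lra.
    - apply Rbar_le_lt_trans with (2 := Hw); simpl; lra. }
  assert (Hf : forall v, D v -> ex_derive f v) by (intros v; apply (hf 1%nat)).
  assert (Hfc : forall v, D v -> continuous f v)
    by (intros v Hv; apply (ex_derive_continuous (K := R_AbsRing)
          (V := R_NormedModule)), Hf, Hv).
  split.
  - intros h Hh.
    eapply third_order_jet_solution; [trivial|].
    now apply third_order_jet_square, sturm_liouville_solution_jet.
  - intros g Hg; apply third_order_solution_jet in Hg.
    destruct (Classical_Prop.classic (exists v, D v)) as [[v0 H0] | Hempty].
    2: { exists nil; split; [intros c h []|].
         intros v Hv; exfalso; apply Hempty; now exists v. }
    destruct (ex_sturm_liouville_jet D f v0 1 0 HDo HDc H0 Hfc)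
      as (h1 & k1 & J1 & h10 & k10).
    destruct (ex_sturm_liouville_jet D f v0 0 1 HDo HDc H0 Hfc)
      as (h2 & k2 & J2 & h20 & k20).
    pose proof (sturm_liouville_jet_plus D f _ _ _ _ J1 J2) as J3.
    (* The jet at [v0] of al h1^2 + 2 be h1 h2 + ga h2^2 is
       (al, 2 be, 2 ga + f(v0) al); the list below is this combination
       after 2 h1 h2 = (h1 + h2)^2 - h1^2 - h2^2. *)
    set (al := g v0); set (be := Derive g v0 / 2).
    set (ga := (Derive_n g 2 v0 - f v0 * g v0) / 2).
    exists ((al - be, h1) :: (ga - be, h2) :: (be, fun v => h1 v + h2 v) :: nil).
    split.
    + intros c h [E | [E | [E | []]]]; injection E as <- <-;
        eapply sturm_liouville_jet_solution; eassumption.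
    + pose proof (third_order_jet_lin D f _ _ _ _ _ _ 1 be
        (third_order_jet_lin D f _ _ _ _ _ _ (al - be) (ga - be)
           (third_order_jet_square D f _ _ Hf J1)
           (third_order_jet_square D f _ _ Hf J2))
        (third_order_jet_square D f _ _ Hf J3)) as HG.
      intros v Hv.
      rewrite (third_order_jet_unique D f _ _ _ _ _ _ v0 HDo HDc Hf Hg HG H0)
        with (v := v); trivial; cbv beta; rewrite ?h10, ?k10, ?h20, ?k20;
        unfold lin_comb_squares, al, be, ga; simpl; field.
Qed.
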